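(* Let $G$ be a graph without isolated vertices, let $\alpha$ be a magnetic potential on $G$, let $\mathbf{G}=(G,\alpha,\deg)$ be the MW-graph with standard weights and $\mathbf{G}'=(G,\alpha,\mathbf{1})$ the MW-graph with combinatorial weights. Then $\mathbf{G}\sqsubseteq\mathbf{G}'$. In particular (for finite $G$) $\mathbf{G}\preccurlyeq\mathbf{G}'$, i.e. $\lambda_k(\mathbf{G})\le\lambda_k(\mathbf{G}')$ for all $1\le k\le|V(G)|$: the (magnetic) eigenvalues of the standard Laplacian are always lower than or equal to the (magnetic) eigenvalues of the combinatorial Laplacian.
   Context: Graphs: a graph $G=(V,E,\partial)$ consists of disjoint, at most countable sets $V$ (vertices) and $E$ (edges), a map $\partial\colon E\to V\times V$, $\partial e=(\partial_-e,\partial_+e)$, and an involution $e\mapsto\bar e$ on $E$ with $e\neq\bar e$ and $\partial_\pm\bar e=\partial_\mp e$. Loops and multiple edges are allowed. $E_v=\{e\in E:\partial_-e=v\}$, $\deg(v)=|E_v|<\infty$ (a loop contributes $2$). A vertex is isolated if its degree is $0$. MW-graphs: a weight $w$ consists of $w\colon V\to(0,\infty)$ and $w\colon E\to(0,\infty)$ with $w_{\bar e}=w_e$. Standard weight $\deg$: $w(v)=\deg(v)$, $w_e=1$. Combinatorial weight $\mathbf{1}$: $w(v)=1$, $w_e=1$. Fix a subgroup $R$ of $\mathbb{R}/2\pi\mathbb{Z}$; a magnetic potential is $\alpha\colon E\to R$ with $\alpha_{\bar e}=-\alpha_e$. An MW-graph is $(G,\alpha,w)$. $\mathbf{G}\sqsubseteq\mathbf{G}'$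 means that there is an MW-homomorphism $\pi\colon\mathbf{G}\to\mathbf{G}'$, i.e. maps $\pi\colon V\to V'$, $\pi\colon E\to E'$ with $\pi(\partial_\pm e)=\partial'_\pm(\pi e)$, $\alpha_e=\alpha'_{\pi e}$ for all $e\in E$, $\sum_{\pi(v)=v'}w(v)\ge w'(v')$ for all $v'\in V'$, and $\sum_{\pi(e)=e'}w_e\le w'_{e'}$ for all $e'\in E'$. For finite $G$, $\lambda_1(\mathbf{G})\le\lambda_2(\mathbf{G})\le\dots$ are the eigenvalues, with multiplicity, of the magnetic Laplacian $(\Delta_\alpha\varphi)(v)=\frac1{w(v)}\sum_{e\in E_v}w_e\bigl(\varphi(v)-\mathrm{e}^{\mathrm{i}\alpha_e}\varphi(\partial_+e)\bigr)$, self-adjoint on $\ell_2(V,w)$. $\mathbf{G}\preccurlyeq\mathbf{G}'$ means $|V|\ge|V'|$ and $\lambda_k(\mathbf{G})\le\lambda_k(\mathbf{G}')$ for $1\le k\le|V'|$. *)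

(* Defs.v *)
From HB Require Import structures.
From mathcomp Require Import all_boot all_order all_algebra.
From mathcomp Require Import generic_quotient ring_quotient.
From mathcomp Require Import finmap complex.
From mathcomp Require Import all_classical all_reals all_analysis.

Set Implicit Arguments.
Unset Strict Implicit.
Unset Printing Implicit Defensive.

Import Order.TTheory GRing.Theory Num.Theory.
Local Open Scope classical_set_scope.
Local Open Scope ring_scope.
Local Open Scope complex_scope.
Local Open Scope quotient_scope.

Section Angle.
Variable R : realType.

(* [angle] is the group R / 2 pi Z. *)
Definition twopiZ : {pred R} := [pred x | x / (pi *+ 2) \is a Num.int].

Lemma twopiZ_zmod_closed : zmod_closed twopiZ.
Proof.
split=> [|x y]; rewrite !inE; first by rewrite mul0r rpred0.
by move=> xZ yZ; rewrite mulrBl rpredB.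
Qed.

HB.instance Definition _ := GRing.isZmodClosed.Build R twopiZ twopiZ_zmod_closed.

Definition angle : Type := Quotient.quot twopiZ.
HB.instance Definition _ := GRing.Zmodule.on angle.

(* exp (i a); [repr] picks some representative, see [expi_pi] for independence
   of the choice. *)
Definition expi (a : angle) : R[i] := cos (repr a) +i* sin (repr a).

Lemma expi_pi (x : R) : expi (\pi_angle x) = cos x +i* sin x.
Proof.
suff [n [E|E]] : exists n : nat,
    repr (\pi_angle x) = x + (pi *+ 2) *+ n
    \/ x = repr (\pi_angle x) + (pi *+ 2) *+ n.
- by rewrite /expi E (periodicn (@cosD2pi R)) (periodicn (@sinD2pi R)).
- by rewrite /expi [in RHS]E (periodicn (@cosD2pi R)) (periodicn (@sinD2pi R)).
have /eqP : \pi_angle (repr (\pi_angle x)) = \pi_angle x by rewrite reprK.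
rewrite -Quotient.idealrBE; set y := repr _.
rewrite inE => /intrP[m Em].
have pi2 : (pi : R) *+ 2 != 0 by rewrite mulrn_eq0 negb_or /= gt_eqF ?pi_gt0.
have {}Em : y - x = m%:~R * (pi *+ 2) by rewrite -Em divfK.
exists `|m|%N; case: (ger0P m) => m0; [left|right].
- by rewrite -(addrNK x y) Em addrC -[in LHS](gez0_abs m0) mulr_natl.
- rewrite -{1}(subKr y x) Em -[in LHS](opprK m) -(ltz0_abs m0).
  by rewrite mulrNz mulNr opprK mulr_natl.
Qed.

Lemma expiN (a : angle) : expi (- a) = (expi a)^*%C.
Proof.
have -> : - a = \pi_angle (- repr a).
  by rewrite -[in LHS](reprK a); exact/esym/(raddfN \pi_(Quotient.quot twopiZ)).
by rewrite expi_pi cosN sinN.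
Qed.

End Angle.

Record graph := Graph {
  vert : countType;
  edge : countType;
  bd : edge -> vert * vert;
  bar : edge -> edge;
  bar_involutive : involutive bar;
  bar_neq : forall e, e != bar e;
  bd_bar : forall e, bd (bar e) = ((bd e).2, (bd e).1);
  (* hence all degrees are finite; a loop contributes [e] and [bar e] *)
  locally_finite : forall v, finite_set [set e | (bd e).1 = v]
}.

Definition tminus (G : graph) (e : edge G) : vert G := (bd e).1.
Definition tplus (G : graph) (e : edge G) : vert G := (bd e).2.

Definition star (G : graph) (v : vert G) : set (edge G) :=
  [set e | tminus e = v].

Definition deg (G : graph) (v : vert G) : nat := #|` fset_set (star v)|.

Definition no_isolated_vertex (G : graph) := forall v : vert G, (0 < deg v)%N.

Definition finite_graph (G : graph) :=
  finite_set [set: vert G] /\ finite_set [set: edge G].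

(* [fset_set] of an infinite set is empty: [vertices] and [nvert] are only
   meaningful for finite graphs. *)
Definition vertices (G : graph) : {fset vert G} := fset_set [set: vert G].
Definition nvert (G : graph) : nat := #|` vertices G|.

Record weight (R : realType) (G : graph) := Weight {
  wv : vert G -> R;
  we : edge G -> R;
  wv_gt0 : forall v, 0 < wv v;
  we_gt0 : forall e, 0 < we e;
  we_bar : forall e, we (bar e) = we e
}.

Record potential (R : realType) (S : zmodClosed (angle R)) (G : graph) :=
  Potential {
    pot : edge G -> angle R;
    pot_in : forall e, pot e \in S;
    pot_bar : forall e, pot (bar e) = - pot e
  }.

Lemma deg_natr_gt0 (R : realType) (G : graph) (hG : no_isolated_vertex G) v :
  0 < (@deg G v)%:R :> R.
Proof. by rewrite ltr0n. Qed.

Definition standard_weight (R : realType) (G : graph)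
    (hG : no_isolated_vertex G) : weight R G :=
  @Weight R G (fun v => (deg v)%:R) (fun=> 1)
    (deg_natr_gt0 R hG)
    (fun=> ltr01) (fun=> erefl).

Definition combinatorial_weight (R : realType) (G : graph) : weight R G :=
  @Weight R G (fun=> 1) (fun=> 1) (fun=> ltr01) (fun=> ltr01) (fun=> erefl).

Record mwgraph (R : realType) (S : zmodClosed (angle R)) := MWGraph {
  mwg : graph;
  mwpot : potential S mwg;
  mww : weight R mwg
}.

(* The sums over fibres may be infinite, hence take values in [0, +oo]. *)
Definition mw_hom (R : realType) (S : zmodClosed (angle R)) (G H : mwgraph S)
    (fv : vert (mwg G) -> vert (mwg H)) (fe : edge (mwg G) -> edge (mwg H)) :=
  [/\ forall e, tminus (fe e) = fv (tminus e) /\ tplus (fe e) = fv (tplus e),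
      forall e, pot (mwpot G) e = pot (mwpot H) (fe e),
      forall v', ((wv (mww H) v')%:E
                    <= \esum_(v in [set v | fv v = v']) (wv (mww G) v)%:E)%E
    & forall e', (\esum_(e in [set e | fe e = e']) (we (mww G) e)%:E
                    <= (we (mww H) e')%:E)%E].

Definition mw_le (R : realType) (S : zmodClosed (angle R)) (G H : mwgraph S) :=
  exists fv fe, @mw_hom R S G H fv fe.

Section Laplacian.
Variables (R : realType) (S : zmodClosed (angle R)) (G : mwgraph S).
Local Notation V := (vert (mwg G)).
Local Notation w := (wv (mww G)).
Local Notation n := (nvert (mwg G)).

Definition laplacian (phi : V -> R[i]) (v : V) : R[i] :=
  ((w v)^-1)%:C *
  \sum_(e \in star v)
     (we (mww G) e)%:C * (phi v - expi (pot (mwpot G) e) * phi (tplus e)).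

Definition vertex (i : 'I_n) : V := tnth (in_tuple (vertices (mwg G))) i.

(* Matrix of [laplacian] in the basis of indicator functions of vertices. *)
Definition laplacian_mx : 'M[R[i]]_n :=
  \matrix_(i, j) laplacian (fun v => (v == vertex j)%:R) (vertex i).

(* [l] lists the roots of the characteristic polynomial with multiplicity. There
   is exactly one such [l], see [eigenvaluesP]; the Laplacian being self-adjoint
   for the weighted inner product ([laplacian_mx_selfadj]), algebraic and
   geometric multiplicities agree. *)
Definition eigenvalue_list (l : seq R) : Prop :=
  sorted <=%R l /\
  char_poly laplacian_mx = \prod_(x <- l) ('X - (x%:C)%:P).

Definition eigenvalues : seq R := xget [::] [set l | eigenvalue_list l].

(* 1-based: [lam 1] is the smallest eigenvalue. *)
Definition lam (k : nat) : R := nth 0 eigenvalues k.-1.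

Lemma laplacian_mx_selfadj i j :
  (w (vertex i))%:C * laplacian_mx i j =
  ((w (vertex j))%:C * laplacian_mx j i)^*%C.
Proof.
pose a := pot (mwpot G); pose we' e := (we (mww G) e)%:C.
pose D (u v : V) := \sum_(e \in star u) we' e * (u == v)%:R.
pose N (u v : V) :=
  \sum_(e \in star u) we' e * (expi (a e) * (tplus e == v)%:R).
have key (i0 j0 : 'I_n) : (w (vertex i0))%:C * laplacian_mx i0 j0 =
    D (vertex i0) (vertex j0) - N (vertex i0) (vertex j0).
  rewrite mxE /laplacian mulrA -rmorphM divff ?mul1r ?gt_eqF ?wv_gt0//.
  rewrite /D /N !fsbig_finite; [|exact: locally_finite..].
  rewrite -sumrB; apply: eq_bigr => e _.
  by rewrite mulrBr.
rewrite !key rmorphB; congr (_ - _).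
  rewrite /D; have [<-|ij] := eqVneq (vertex i) (vertex j).
    rewrite !fsbig_finite; [|exact: locally_finite..].
    rewrite rmorph_sum; apply: eq_bigr => e _.
    by rewrite mulr1 /= /we' oppr0.
  by rewrite !fsbig1 ?rmorph0 // => e _; rewrite mulr0.
have NE u v : N u v =
    \sum_(e \in star u `&` [set e | tplus e = v]) we' e * expi (a e).
  rewrite fsbig_mkcondr /N; apply: eq_fsbigr => e _.
  have -> : (e \in [set e | tplus e = v]) = (tplus e == v).
    by apply/idP/eqP; rewrite inE.
  by case: eqP => _; rewrite ?mulr1 // !mulr0.
set u := vertex i; set v := vertex j.
have fin x y : finite_set (star x `&` [set e : edge (mwg G) | tplus e = y]).
  by apply: finite_setIl; exact: locally_finite.
rewrite !NE [in RHS]fsbig_finite ?rmorph_sum -?fsbig_finite //.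
rewrite [LHS](@reindex_fsbig _ _ _ _ _ (@bar (mwg G)) (star v `&` [set e | tplus e = u])).
  apply: eq_fsbigr => e _.
  by rewrite rmorphM /we' we_bar /a pot_bar expiN /= oppr0.
split.
- by move=> e [/= ev eu]; rewrite /star /tminus /tplus /= bd_bar.
- by move=> e e' _ _; exact: (inv_inj (@bar_involutive (mwg G))).
- move=> e [/= eu ev]; exists (bar e); last exact: bar_involutive.
  by rewrite /star /tminus /tplus /= bd_bar.
Qed.

Lemma laplacian_mx_eigenvalue_real a :
  eigenvalue laplacian_mx a -> a = (complex.Re a)%:C.
Proof.
move=> /eigenvalueP[v vM v0].
pose wi i := ((w (vertex i))%:C)^-1.
have wi_gt0 i : 0 < wi i by rewrite invr_gt0 (ltcR 0) wv_gt0.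
have wJ i : (wi i)^*%C = wi i by rewrite /wi fmorphV /= oppr0.
have w_neq0 i : (w (vertex i))%:C != 0 by rewrite gt_eqF // (ltcR 0) wv_gt0.
pose B := \sum_j v 0 j * (v 0 j)^*%C * wi j.
have B_gt0 : 0 < B.
  rewrite lt0r sumr_ge0 => [|j _]; last by rewrite mulr_ge0 ?mulcJ_ge0 ?ltW.
  rewrite andbT; apply: contra_neq v0 => /eqP; rewrite psumr_eq0 => [/allP B0|j _].
    apply/rowP => j; rewrite mxE; have := B0 j (mem_index_enum _).
    by rewrite /= !mulf_eq0 conjc_eq0 orbb (gt_eqF (wi_gt0 j)) orbF => /eqP.
  by rewrite mulr_ge0 ?mulcJ_ge0 ?ltW.
pose N i j := laplacian_mx i j * wi j.
have JM (x y : R[i]) : (x * y)^*%C = x^*%C * y^*%C by exact: rmorphM.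
have Jsum (F : 'I_n -> R[i]) : (\sum_i F i)^*%C = \sum_i (F i)^*%C.
  exact: (rmorph_sum (@conjc R)).
have NJ i j : N i j = (N j i)^*%C.
  have := laplacian_mx_selfadj i j; rewrite JM conjc_real => E.
  rewrite /N JM wJ; apply: (mulfI (w_neq0 i)); rewrite mulrA E.
  by rewrite mulrAC /wi divff // mul1r mulrCA divff // mulr1.
have aB : a * B = \sum_i \sum_j v 0 i * (v 0 j)^*%C * N i j.
  rewrite exchange_big mulr_sumr; apply: eq_bigr => j _ /=.
  have /matrixP/(_ 0 j) := vM; rewrite !mxE => E.
  rewrite !mulrA -E !mulr_suml; apply: eq_bigr => i _.
  by rewrite /N !mulrA; congr (_ * _); rewrite mulrAC.
have aBJ : (a * B)^*%C = a * B.
  rewrite aB Jsum exchange_big; apply: eq_bigr => i _ /=.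
  rewrite Jsum; apply: eq_bigr => j _ /=.
  by rewrite JM JM conjcK -NJ; congr (_ * _); exact: mulrC.
have BJ : B^*%C = B.
  rewrite Jsum; apply: eq_bigr => i _ /=.
  by rewrite JM JM conjcK wJ; congr (_ * _); exact: mulrC.
have aJ : a^*%C = a.
  by apply: (mulIf (lt0r_neq0 B_gt0)); rewrite -[X in _ * X]BJ -JM aBJ.
case: a aJ {vM aB aBJ} => x y [] /eqP; rewrite eqNr => /eqP ->.
by [].
Qed.

Lemma eigenvaluesP : eigenvalue_list eigenvalues.
Proof.
apply: (xgetPex [::] (P := [set l | eigenvalue_list l])).
have [r Er] := closed_field_poly_normal (char_poly laplacian_mx).
rewrite (monicP (char_poly_monic _)) scale1r in Er.
exists (sort <=%R (map (@complex.Re R) r)); split.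
  exact: (sort_sorted le_total).
rewrite Er (perm_big (map (@complex.Re R) r)); last by rewrite perm_sort.
rewrite big_map big_seq [RHS]big_seq; apply: eq_bigr => z zr.
rewrite -(@laplacian_mx_eigenvalue_real z)// eigenvalue_root_char Er.
by rewrite root_prod_XsubC.
Qed.

End Laplacian.

(* Meaningful for finite graphs only. *)
Definition spec_le (R : realType) (S : zmodClosed (angle R))
    (G H : mwgraph S) : Prop :=
  (nvert (mwg H) <= nvert (mwg G))%N /\
  forall k, (1 <= k <= nvert (mwg H))%N -> lam G k <= lam H k.

(* Main.v *)
Require Import Defs.
From HB Require Import structures.
From mathcomp Require Import all_boot all_order all_algebra complex finmap.
From mathcomp Require Import all_classical all_reals all_analysis.
From mathcomp Require Import ring.

(** The identity map of [G] is a homomorphism from the standard to the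
    combinatorial weight: the edge weights agree, and in the absence of isolated
    vertices each degree is at least [1].

    For the eigenvalues, write [L1], [L2] for the standard and combinatorial
    Laplacians and [D] for the diagonal matrix of degrees. Multiplying a
    Laplacian by its vertex weights leaves a form that depends on the edges only,
    so [D L1 = L2 =: M], and both spectra are given by Rayleigh quotients with
    the same numerator: [<M u, u> / <D u, u>] and [<M u, u> / <u, u>]. As
    [D >= 1], the first denominator is the larger one, and as [M] is
    nonnegative the first quotient is the smaller one; the min-max principle
    then compares the eigenvalues one by one.

    The min-max principle is used through counting functions. Each weighted
    problem is diagonalised by the spectral theorem ([weighted_spectral]). For
    [x >= 0], if more eigenvalues of [L2] than of [L1] were at most [x], a
    dimension count ([exists_supported_row]) would give a nonzero vector spanned
    by eigenvectors of [L2] with eigenvalue at most [x] and also by eigenvectors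
    of [L1] with eigenvalue above [x]; its two Rayleigh quotients contradict the
    previous paragraph ([card_sublevel_le], [count_eigenvalue_le]). Taking for
    [x] the k-th eigenvalue of [L2], which is nonnegative by a Gershgorin
    argument ([laplacian_mx_eigenvalue_ge0]), gives the inequality for any two
    weights with equal edge weights and ordered vertex weights
    ([lam_le_vertex_weight]). *)

Set Implicit Arguments.
Unset Strict Implicit.
Unset Printing Implicit Defensive.

Import Order.TTheory GRing.Theory Num.Theory.
Local Open Scope ring_scope.

(** * Comparison of two diagonal forms *)

(** Restricting to [A] and then reading off the coordinates in [B] maps a space of
    dimension [#|A|] to one of smaller dimension [#|B|], so it has a kernel. *)
Lemma exists_supported_row (F : fieldType) m n (K : 'M[F]_(m, n))
    (A : {set 'I_m}) (B : {set 'I_n}) : (#|B| < #|A|)%N ->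
  exists y : 'rV_m, [/\ y != 0, forall i, i \notin A -> y 0 i = 0
    & forall j, j \in B -> (y *m K) 0 j = 0].
Proof.
move=> ltBA.
(* [v *m E] extends [v] by zero outside of [A]. *)
pose E := rowsub (fun i : 'I_#|A| => enum_val i) (1%:M : 'M[F]_m).
pose M := mxsub (fun i : 'I_#|A| => enum_val i) (fun j : 'I_#|B| => enum_val j) K.
have kerM : kermx M != 0.
  rewrite -mxrank_eq0 mxrank_ker subn_eq0 -ltnNge.
  exact: leq_ltn_trans (rank_leq_col M) ltBA.
pose v := nz_row (kermx M).
have vM : v *m M = 0 by apply/sub_kermxP/nz_row_sub.
have vEK : v *m E *m K = v *m rowsub (fun i : 'I_#|A| => enum_val i) K.
  by rewrite -mulmxA mul_rowsub_mx mul1mx.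
have vE (i : 'I_#|A|) : (v *m E) 0 (enum_val i) = v 0 i.
  rewrite mxE (bigD1 i) //= !mxE eqxx mulr1 big1 ?addr0 // => j ji.
  by rewrite !mxE (inj_eq enum_val_inj) (negPf ji) mulr0.
exists (v *m E); split.
- apply: contraNneq kerM => vE0; rewrite -nz_row_eq0; apply/eqP/rowP => i.
  by rewrite -/v -vE vE0 !mxE.
- move=> i iA; rewrite mxE big1 // => j _; rewrite !mxE.
  by case: eqP iA => [<-|_ _]; rewrite ?enum_valP // mulr0.
- move=> j jB; rewrite vEK.
  have /rowP/(_ (enum_rank_in jB j)) := vM; rewrite [LHS]mxE [RHS]mxE => vMj.
  rewrite -[RHS]vMj mxE; apply: eq_bigr => i _.
  by rewrite !mxE enum_rankK_in.
Qed.

(** The min-max principle in counting form. If the claim failed, some [y <> 0]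
    would be supported where [a <= x] with [z = y K] supported where [b > x]; then
    [x |z|^2 <= b(z) <= a(y) <= x |y|^2 <= x |z|^2] forces [b(z) = x |z|^2], hence
    [z = 0] and [y = 0]. The last inequality of the chain is where [0 <= x] is
    used. *)
Lemma card_sublevel_le (C : numFieldType) m n (K : 'M[C]_(m, n))
    (a : 'I_m -> C) (b : 'I_n -> C) (x : C) :
  (forall j, b j \is Num.real) -> 0 <= x ->
  (forall y : 'rV_m,
    \sum_j b j * `|(y *m K) 0 j| ^+ 2 <= \sum_i a i * `|y 0 i| ^+ 2) ->
  (forall y : 'rV_m, \sum_i `|y 0 i| ^+ 2 <= \sum_j `|(y *m K) 0 j| ^+ 2) ->
  (#|[set i | (a i <= x)%R]| <= #|[set j | (b j <= x)%R]|)%N.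
Proof.
move=> bR x0 form_le norm_le; rewrite leqNgt; apply/negP.
move=> /(exists_supported_row K)[y [y0 yA yB]].
set z := y *m K in yB.
have term_ge0 j : 0 <= (b j - x) * `|z 0 j| ^+ 2.
  have [bx|] := boolP (b j <= x).
    by rewrite yB ?inE // normr0 expr0n mulr0.
  rewrite -real_ltNge ?bR ?(ger0_real x0) // => xb.
  by rewrite mulr_ge0 ?exprn_ge0 // subr_ge0 ltW.
have sum_le0 : \sum_j (b j - x) * `|z 0 j| ^+ 2 <= 0.
  under eq_bigr do rewrite mulrBl.
  rewrite sumrB subr_le0 (le_trans (form_le y)) //.
  apply: (@le_trans _ _ (\sum_i x * `|y 0 i| ^+ 2)).
    apply: ler_sum => i _; have [ax|ax] := boolP (a i <= x).
      by rewrite ler_wpM2r ?exprn_ge0.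
    by rewrite yA ?inE // normr0 expr0n !mulr0.
  by rewrite -!mulr_sumr ler_wpM2l.
have z0 j : z 0 j = 0.
  have [bx|bx] := boolP (b j <= x); first by rewrite yB ?inE.
  have /eqP : (b j - x) * `|z 0 j| ^+ 2 = 0.
    apply: (psumr_eq0P (P := predT) (F := fun j => (b j - x) * `|z 0 j| ^+ 2)) => //.
    by apply/le_anti; rewrite sum_le0 sumr_ge0.
  rewrite mulf_eq0 subr_eq0 expf_eq0 normr_eq0 /= => /orP[/eqP bxE|/eqP //].
  by rewrite bxE lexx in bx.
case/eqP: y0; apply/rowP => i; rewrite mxE.
have /(psumr_eq0P _)/(_ i isT)/eqP : \sum_i `|y 0 i| ^+ 2 = 0.
  apply/le_anti; rewrite [X in _ && X]sumr_ge0 => [|? _]; last exact: exprn_ge0.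
  rewrite andbT (le_trans (norm_le y)) // big1 // => j _.
  by rewrite -/z z0 normr0 expr0n.
by rewrite expf_eq0 normr_eq0 /= => E; apply/eqP/E => ? _; exact: exprn_ge0.
Qed.

(** * Diagonalisation of a matrix that is self-adjoint for a weight *)

(** Over polynomials, [P] also intertwines the two characteristic matrices, and
    its determinant cancels. *)
Lemma char_poly_intertwined (F : fieldType) n (P A B : 'M[F]_n) :
  P \in unitmx -> P *m B = A *m P -> char_poly B = char_poly A.
Proof.
move=> Pu PB; pose Q := map_mx polyC P.
have E : Q *m char_poly_mx B = char_poly_mx A *m Q.
  rewrite /char_poly_mx mulmxBr mulmxBl -!map_mxM PB.
  by rewrite scalar_mxC.
have : \det (Q *m char_poly_mx B) = \det (char_poly_mx A *m Q) by rewrite E.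
rewrite !det_mulmx [RHS]mulrC; apply: mulfI.
by rewrite det_map_mx polyC_eq0 -unitfE -unitmxE.
Qed.

Local Open Scope sesquilinear_scope.

(** With [s = sqrt w], the matrix [N = s L s^-1] is Hermitian and has the spectrum
    of [L]; a unitary diagonalisation [P] of [N] gives [Z = s P^*]. The forms of
    [w L] and [w] become [sum b_i |(u Z)_i|^2] and [sum |(u Z)_i|^2], so that [b]
    and [1] play the roles of numerator and denominator of the Rayleigh
    quotient. *)
Lemma weighted_spectral (C : numClosedFieldType) n (L : 'M[C]_n) (w : 'rV[C]_n) :
  (forall i, 0 < w 0 i) ->
  (forall i j, w 0 i * L i j = (w 0 j * L j i)^*) ->
  exists (Z : 'M[C]_n) (b : 'rV[C]_n),
    [/\ Z \in unitmx, forall i, b 0 i \is Num.real,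
        char_poly L = \prod_i ('X - (b 0 i)%:P),
        Z *m diag_mx b *m Z^t* = diag_mx w *m L & Z *m Z^t* = diag_mx w].
Proof.
move=> w_gt0 wL.
pose s := \row_i sqrtC (w 0 i); pose t := \row_i (sqrtC (w 0 i))^-1.
have s_neq0 i : sqrtC (w 0 i) != 0 by rewrite sqrtC_eq0 gt_eqF.
have sJ i : (sqrtC (w 0 i))^* = sqrtC (w 0 i).
  by apply/conj_Creal/ger0_real; rewrite sqrtC_ge0 ltW.
have sI : diag_mx s *m diag_mx t = 1%:M.
  rewrite mulmx_diag -diag_const_mx; congr diag_mx; apply/rowP => i.
  by rewrite !mxE divff.
have st : (diag_mx s)^t* = diag_mx s.
  by apply/matrixP => i j; rewrite !mxE rmorphMn /= sJ eq_sym; case: eqP => // ->.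
have ss : diag_mx s *m diag_mx s = diag_mx w.
  rewrite mulmx_diag; congr diag_mx; apply/rowP => i.
  by rewrite !mxE -expr2 sqrtCK.
pose N := diag_mx s *m L *m diag_mx t.
have NE i j : N i j = w 0 i * L i j / (sqrtC (w 0 i) * sqrtC (w 0 j)).
  rewrite /N mul_mx_diag mul_diag_mx !mxE invfM.
  by rewrite -[in w 0 i * _](sqrtCK (w 0 i)) expr2; field; rewrite !s_neq0.
have Nh : N \is hermsymmx.
  apply/is_hermitianmxP; rewrite expr0 scale1r; apply/matrixP => i j.
  rewrite [RHS]mxE [(_^T) i j]mxE !NE wL.
  rewrite [RHS]rmorphM fmorphV [in RHS](rmorphM _ (sqrtC _)) /= !sJ.
  by rewrite [X in _ = _ / X]mulrC.
have /orthomx_spectralP := hermitian_normalmx Nh.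
set P := spectralmx N; set b := spectral_diag N => defN.
have Punitary : P \is unitarymx := spectral_unitarymx N.
have Pu : P \in unitmx := spectral_unit N.
rewrite invmx_unitary // in defN.
have su : diag_mx s \in unitmx by case: (mulmx1_unit sI).
have NS : N *m diag_mx s = diag_mx s *m L.
  by rewrite -mulmxA (mulmx1C sI) mulmx1.
exists (diag_mx s *m P^t*), b; split.
- by rewrite unitmx_mul su -invmx_unitary // unitmx_inv.
- by move=> i; have /mxOverP := hermitian_spectral_diag_real Nh; apply.
- rewrite (@char_poly_intertwined _ _ (P *m diag_mx s) (diag_mx b)).
  + rewrite char_poly_trig ?diag_mx_is_trig //.
    by apply: eq_bigr => i _; rewrite mxE eqxx mulr1n.
  + by rewrite unitmx_mul Pu.
  + rewrite -mulmxA -NS {1}defN !mulmxA.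
    by rewrite (unitarymxP Punitary) mul1mx.
- rewrite trmx_mul map_mxM /= st trmxCK.
  rewrite !mulmxA -[_ *m P^t* *m _ *m P]mulmxA.
  rewrite -!mulmxA [P^t* *m _]mulmxA [_ *m (_ *m diag_mx s)]mulmxA -defN.
  by rewrite NS mulmxA ss.
- rewrite trmx_mul map_mxM /= st trmxCK.
  rewrite mulmxA -[_ *m P^t* *m P]mulmxA.
  by rewrite -[P^t*]invmx_unitary // mulVmx // mulmx1 ss.
Qed.

Lemma diag_formE (C : numClosedFieldType) n (v b : 'rV[C]_n) :
  (v *m diag_mx b *m v^t*) 0 0 = \sum_i b 0 i * `|v 0 i| ^+ 2.
Proof.
rewrite mxE; apply: eq_bigr => i _.
by rewrite mul_mx_diag !mxE normCK mulrA [v 0 i * _]mulrC.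
Qed.

(** Passing from [w2] to the larger weight [w1] while keeping the form [w L]
    divides the Rayleigh quotient by a factor at least [1], which moves the
    eigenvalues down as long as they are nonnegative. *)
Lemma count_eigenvalue_le (C : numClosedFieldType) n (L1 L2 : 'M[C]_n)
    (w1 w2 : 'rV[C]_n) (l1 l2 : seq C) (x : C) :
  (forall i, 0 < w2 0 i <= w1 0 i) ->
  diag_mx w1 *m L1 = diag_mx w2 *m L2 ->
  (forall i j, w2 0 i * L2 i j = (w2 0 j * L2 j i)^*) ->
  char_poly L1 = \prod_(z <- l1) ('X - z%:P) ->
  char_poly L2 = \prod_(z <- l2) ('X - z%:P) ->
  0 <= x ->
  (count (fun z => z <= x)%R l2 <= count (fun z => z <= x)%R l1)%N.
Proof.
move=> w_le wL12 wL2 charL1 charL2 x0.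
have w2_gt0 i : 0 < w2 0 i by case/andP: (w_le i).
have w1_gt0 i : 0 < w1 0 i by case/andP: (w_le i) => /lt_le_trans; apply.
have wL1 i j : w1 0 i * L1 i j = (w1 0 j * L1 j i)^*.
  have entry k l : w1 0 k * L1 k l = w2 0 k * L2 k l.
    by have /matrixP/(_ k l) := wL12; rewrite !mul_diag_mx !mxE.
  by rewrite !entry wL2.
have [Z1 [b1 [_ b1R char1 form1 norm1]]] := weighted_spectral w1_gt0 wL1.
have [Z2 [b2 [Z2u b2R char2 form2 norm2]]] := weighted_spectral w2_gt0 wL2.
have countE l (L : 'M[C]_n) (b : 'rV[C]_n) :
    char_poly L = \prod_(z <- l) ('X - z%:P) ->
    char_poly L = \prod_i ('X - (b 0 i)%:P) ->
    count (fun z => z <= x)%R l = #|[set i | (b 0 i <= x)%R]|.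
  move=> -> charb; have /permP-> : perm_eq l (codom (b 0)).
    by apply: prod_XsubC_eq; rewrite charb big_map enumT.
  rewrite cardsE cardE /enum_mem size_filter count_map enumT.
  by apply: eq_count => i.
rewrite (countE l1 L1 b1) // (countE l2 L2 b2) //.
have coordE (y : 'rV_n) : y *m (invmx Z2 *m Z1) = y *m invmx Z2 *m Z1.
  exact: mulmxA.
(* The matrix passes from coordinates in the eigenbasis of [L2] to coordinates in
   the eigenbasis of [L1]. *)
apply: (card_sublevel_le (K := invmx Z2 *m Z1)) => // y.
- have {2}-> : y = y *m invmx Z2 *m Z2 by rewrite mulmxKV.
  rewrite coordE; set u := y *m invmx Z2.
  have formE (Z M : 'M[C]_n) (b : 'rV[C]_n) : Z *m diag_mx b *m Z^t* = M ->
      \sum_i b 0 i * `|(u *m Z) 0 i| ^+ 2 = (u *m M *m u^t*) 0 0.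
    by move=> <-; rewrite -diag_formE trmx_mul map_mxM !mulmxA.
  by rewrite (formE _ _ _ form1) (formE _ _ _ form2) wL12.
- have {1}-> : y = y *m invmx Z2 *m Z2 by rewrite mulmxKV.
  rewrite coordE; set u := y *m invmx Z2.
  have sqnormE (Z : 'M[C]_n) (w : 'rV[C]_n) : Z *m Z^t* = diag_mx w ->
      \sum_i `|(u *m Z) 0 i| ^+ 2 = \sum_i w 0 i * `|u 0 i| ^+ 2.
    move=> ZZ; rewrite -diag_formE -ZZ mulmxA -mulmxA -map_mxM -trmx_mul mxE.
    by apply: eq_bigr => i _; rewrite normCK !mxE.
  rewrite (sqnormE _ _ norm1) (sqnormE _ _ norm2).
  apply: ler_sum => i _; rewrite ler_wpM2r ?exprn_ge0 //.
  by case/andP: (w_le i).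
Qed.

(** * Nonnegativity of the magnetic Laplacian *)

Local Open Scope complex_scope.

Lemma norm_expi (R : realType) (a : angle R) : `|expi a| = 1.
Proof.
apply/eqP; rewrite -(@eqrXn2 _ 2) // expr1n.
rewrite sqr_normc /expi; apply/eqP; simpc.
by rewrite -!expr2 cos2Dsin2 mulrC addNr.
Qed.

Lemma vertex_inj (R : realType) (S : zmodClosed (angle R)) (G : mwgraph S) :
  injective (@vertex R S G).
Proof. by apply/tuple_uniqP; exact: fset_uniq. Qed.

(** The matrix acts on the column of values of a function on the vertices, which
    lets the eigenvector equation be read at a single vertex. *)
Lemma laplacian_mx_mul (R : realType) (S : zmodClosed (angle R)) (G : mwgraph S)
    (v : 'I_(nvert (mwg G)) -> R[i]) i :
  \sum_j laplacian_mx G i j * v j =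
  @laplacian R S G (fun x => \sum_j v j * (x == vertex j)%:R) (vertex i).
Proof.
rewrite /laplacian !fsbig_finite; [|exact: locally_finite..].
transitivity (((wv (mww G) (vertex i))^-1)%:C *
  \sum_j \sum_(e <- fset_set (star (vertex i)))
     ((we (mww G) e)%:C * ((vertex i == vertex j)%:R -
        expi (pot (mwpot G) e) * (tplus e == vertex j)%:R)) * v j).
  rewrite mulr_sumr; apply: eq_bigr => j _.
  rewrite mxE /laplacian fsbig_finite; last exact: locally_finite.
  by rewrite -mulrA mulr_suml.
rewrite exchange_big; congr (_ * _); apply: eq_bigr => e _ /=.
rewrite mulr_sumr -sumrB mulr_sumr; apply: eq_bigr => j _.
by ring.
Qed.

(** Gershgorin: each row of the Laplacian is diagonally dominant. At a vertex [i]
    where an eigenvector [phi] is largest, the equation reads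
    [(W - w_i a) phi_i = sum w_e exp(i alpha_e) phi(e+)], where [W] is the sum of
    the [w_e] over the edges at [i]; hence [|W - w_i a| <= W] and, [a] being
    real, [0 <= a]. *)
Lemma laplacian_mx_eigenvalue_ge0 (R : realType) (S : zmodClosed (angle R))
    (G : mwgraph S) a :
  eigenvalue (laplacian_mx G) a -> 0 <= a.
Proof.
move=> eva.
have aR : a \is Num.real.
  by rewrite (laplacian_mx_eigenvalue_real eva) complex_real.
(* [eigenvalue] provides a row vector; transposing gives a column one. *)
have [v v0 vL] : exists2 v : 'rV_(nvert (mwg G)), v != 0 &
    forall i, \sum_j laplacian_mx G i j * v 0 j = a * v 0 i.
  have [u uL u0] := eigenvalueP eva.
  have : \det (laplacian_mx G - a%:M)^T == 0.
    rewrite det_tr; apply/det0P; exists u => //.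
    by rewrite mulmxBr uL mul_mx_scalar subrr.
  move=> /det0P[v v0 /rowP vL]; exists v => // i; apply/eqP.
  have := vL i; rewrite linearB /= tr_scalar_mx mulmxBr mul_mx_scalar !mxE.
  move/eqP; rewrite subr_eq0; congr (_ == _).
  by apply: eq_bigr => j _; rewrite mxE mulrC.
have [k vk] : exists k, v 0 k != 0.
  apply/existsP; rewrite -negb_forall; apply: contra v0 => /forallP v_eq0.
  by apply/eqP/rowP => k; rewrite mxE; apply/eqP.
(* The order of [R[i]] is partial, so the maximum is taken over real parts. *)
have normRe (z : R[i]) : `|z| = (complex.Re `|z|)%:C by rewrite normc_def.
pose i := [arg max_(i > k) complex.Re `|v 0 i|]%O.
have vmax j : `|v 0 j| <= `|v 0 i|.
  rewrite normRe [leRHS]normRe lecR /i.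
  by case: arg_maxP => // i0 _; apply.
have vi0 : 0 < `|v 0 i| by rewrite (lt_le_trans _ (vmax k)) ?normr_gt0.
(* On vertices outside of the enumeration, [phi] is [0]. *)
pose phi x := \sum_j v 0 j * (x == vertex j)%:R.
have phi_vertex j : phi (vertex j) = v 0 j.
  rewrite /phi (bigD1 j) //= eqxx mulr1 big1 ?addr0 // => l lj.
  by rewrite (inj_eq (@vertex_inj _ _ G)) eq_sym (negPf lj) mulr0.
have phi_le x : `|phi x| <= `|v 0 i|.
  have [[j ->]|xV] := pselect (exists j, x = vertex j).
    by rewrite phi_vertex.
  rewrite /phi big1 ?normr0 ?ltW // => j _.
  by case: eqP => [xj|]; [case: xV; exists j | rewrite mulr0].
pose c := (wv (mww G) (vertex i))%:C.
pose W := \sum_(e <- fset_set (star (vertex i))) (we (mww G) e)%:C.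
have c0 : 0 < c by rewrite ltcR wv_gt0.
have we0 e : 0 <= (we (mww G) e)%:C by rewrite lecR ltW ?we_gt0.
have W0 : 0 <= W by rewrite sumr_ge0.
have eqi : (W - c * a) * v 0 i =
    \sum_(e <- fset_set (star (vertex i)))
       (we (mww G) e)%:C * (expi (pot (mwpot G) e) * phi (tplus e)).
  rewrite mulrBl -mulrA -vL laplacian_mx_mul -/phi /laplacian.
  rewrite fsbig_finite; last exact: locally_finite.
  rewrite mulrA -rmorphM divff ?gt_eqF ?wv_gt0 // mul1r phi_vertex.
  by rewrite mulr_suml -sumrB; apply: eq_bigr => e _; ring.
have : `|W - c * a| <= W.
  rewrite -(ler_pM2r vi0) -normrM eqi (le_trans (ler_norm_sum _ _ _)) //.
  rewrite mulr_suml; apply: ler_sum => e _.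
  by rewrite !normrM norm_expi mul1r (ger0_norm (we0 e)) ler_wpM2l.
have WR : W - c * a \is Num.real.
  by rewrite rpredB ?rpredM // ger0_real // ltW.
move/(le_trans (real_ler_norm WR)); rewrite lerBlDr lerDl.
by rewrite pmulr_rge0.
Qed.

Lemma eigenvalues_ge0 (R : realType) (S : zmodClosed (angle R))
    (G : mwgraph S) x :
  x \in eigenvalues G -> 0 <= x.
Proof.
move=> xG; rewrite -lecR; apply: (@laplacian_mx_eigenvalue_ge0 _ _ G).
have [_ charL] := eigenvaluesP G.
rewrite eigenvalue_root_char charL -(big_map _ predT (fun z => 'X - z%:P)).
by rewrite root_prod_XsubC map_f.
Qed.

Lemma size_eigenvalues (R : realType) (S : zmodClosed (angle R)) (G : mwgraph S) :
  size (eigenvalues G) = nvert (mwg G).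
Proof.
have [_ charL] := eigenvaluesP G.
by have := size_char_poly (laplacian_mx G); rewrite charL size_prod_XsubC => -[].
Qed.

(** * Comparison of the eigenvalues *)

Lemma nth_le_of_count d (T : orderType d) (x0 : T) (s t : seq T) i :
  sorted <=%O s -> sorted <=%O t -> (i < size t)%N ->
  (count (<= nth x0 t i)%O t <= count (<= nth x0 t i)%O s)%N ->
  (nth x0 s i <= nth x0 t i)%O.
Proof.
move=> sorted_s sorted_t it count_le; apply: nth_count_le => //.
apply: leq_trans count_le; rewrite ltnNge; apply/negP => le_i.
have := @nth_count_gt _ _ (nth x0 t i) x0 t i sorted_t.
by rewrite le_i it ltxx => /(_ isT).
Qed.

(** The form [w L] sees the vertex weight only through [w w^-1], so both
    Laplacians have the same form and [count_eigenvalue_le] applies at the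
    k-th eigenvalue for [w']. *)
Lemma lam_le_vertex_weight (R : realType) (S : zmodClosed (angle R)) (G : graph)
    (alpha : potential S G) (w w' : weight R G) k :
  we w =1 we w' -> (forall v, wv w' v <= wv w v) -> (1 <= k <= nvert G)%N ->
  lam (MWGraph alpha w) k <= lam (MWGraph alpha w') k.
Proof.
move=> we_eq wv_le /andP[k_gt0 k_le]; rewrite /lam.
have i_lt : (k.-1 < nvert G)%N by rewrite prednK.
move: (k.-1) i_lt => i i_lt {k k_gt0 k_le}.
set H := MWGraph alpha w; set H' := MWGraph alpha w'.
have [sortedH charH] := eigenvaluesP H.
have [sortedH' charH'] := eigenvaluesP H'.
have i_lt' : (i < size (eigenvalues H'))%N by rewrite size_eigenvalues.
apply: (nth_le_of_count sortedH sortedH' i_lt').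
have x0 : 0 <= nth 0 (eigenvalues H') i.
  by apply: (@eigenvalues_ge0 _ _ H'); rewrite mem_nth.
move: (nth 0 _ i) x0 => x x0.
have countC (s : seq R) :
    count (fun z => z <= x%:C)%R (map (real_complex R) s) = count (<= x) s.
  by rewrite count_map; apply: eq_count => z; rewrite /= lecR.
rewrite -!countC.
pose wr (u : weight R G) : 'rV[R[i]]_(nvert G) :=
  \row_i (wv u (@vertex R S H i))%:C.
apply: (@count_eigenvalue_le _ _ (laplacian_mx H) (laplacian_mx H') (wr w) (wr w')).
- by move=> j; rewrite !mxE lecR ltcR wv_gt0 wv_le.
- rewrite !mul_diag_mx; apply/matrixP => j m; rewrite !mxE /laplacian.
  rewrite !mulrA -!rmorphM !divff ?gt_eqF ?wv_gt0 //.
  congr (_ * _); apply: eq_fsbigr => e _.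
  by rewrite /= we_eq.
- by move=> j m; have := @laplacian_mx_selfadj _ _ H' j m; rewrite !mxE.
- by rewrite charH big_map.
- by rewrite charH' big_map.
- by rewrite lecR.
Qed.

Theorem corollary3p16 (R : realType) (S : zmodClosed (angle R)) (G : graph)
    (hG : no_isolated_vertex G) (alpha : potential S G) :
  mw_le (MWGraph alpha (standard_weight R hG))
        (MWGraph alpha (combinatorial_weight R G)) /\
  (finite_graph G ->
    spec_le (MWGraph alpha (standard_weight R hG))
            (MWGraph alpha (combinatorial_weight R G)) /\
    forall k : nat, (1 <= k <= nvert G)%N ->
      lam (MWGraph alpha (standard_weight R hG)) k <=
      lam (MWGraph alpha (combinatorial_weight R G)) k).
Proof.
have deg_ge1 v : 1 <= (@deg G v)%:R :> R by rewrite ler1n.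
have lam_le k : (1 <= k <= nvert G)%N ->
    lam (MWGraph alpha (standard_weight R hG)) k <=
    lam (MWGraph alpha (combinatorial_weight R G)) k.
  exact: lam_le_vertex_weight.
split; last by move=> _; split => //; split.
exists id, id; split => //= [v|e].
- by rewrite esum_set1 ?lee_fin // (le_trans ler01).
- by rewrite esum_set1 ?lee_fin.
Qed.
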